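(* Let $A\subseteq\omega$ be an infinite c.e. set, $n\ge1$, and let $\theta^{(n)}$ be a numbering of $\mathcal S^{(n)}_A$ satisfying condition (QGN I), i.e. the extended graph of the $(n+1)$-ary function $(i,\vec x)\mapsto\theta^{(n)}_i(\vec x)$ is the range of a total computable function $\omega\to\omega$. Then there are a primitive recursive function $q:\omega\to\omega$ and an $(n+2)$-ary computable predicate $T$ such that for all $i\in\omega$ and $\vec x\in\omega^n$, $$\theta^{(n)}_i(\vec x)=q\big(\mu y.\,T(i,\vec x,y)\big)$$ (both sides being undefined or both being defined and equal).
   Context: $\omega$ is the set of natural numbers; $\mathcal R^{(n)}$ is the set of total computable functions $\omega^n\to\omega$. $\langle\cdot,\cdot\rangle:\omega^2\to\omega$ is a computable bijection with $\langle x,y\rangle\ge x,y$ (it may be chosen primitive recursive with primitive recursive inverses), extended by $\langle x\rangle=x$, $\langle x_1,\dots,x_{n+1}\rangle=\langle x_1,\langle x_2,\dots,x_{n+1}\rangle\rangle$. $\mathrm{Anf}^{(n)}_A$ is the set of partial functions from $\omega^n$ to $\omega$ whose domain is either empty or equal to $\{0,\dots,a-1\}^n$ for some $a\in A$, and $\mathcal S^{(n)}_A=\mathcal R^{(n)}\cup\mathrm{Anf}^{(n)}_A$. A numbering of a set $X$ is a surjection $\omega\to X$. The extended graph of an $m$-ary partial function $q$ is $\{\langle\langle\vec y\rangle,0\rangle:\vec y\in\omega^m\}\cup\{\langle\langle\vec x\rangle,q(\vec x)+1\rangle:\vec x\in\mathrm{dom}(q)\}$. $\mu y.\,T(i,\vec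 x,y)$ is the least $y$ with $T(i,\vec x,y)$, undefined if there is none. *)

(* Defs.v *)
From mathcomp Require Import all_boot.
From mathcomp Require Import boolp classical_sets functions cardinality.

Set Implicit Arguments.
Unset Strict Implicit.
Unset Printing Implicit Defensive.

Local Open Scope classical_set_scope.

(* Minimization is not effective, so it is defined classically, as a total     *)
(* operation with [None] for "undefined".                                      *)
Definition mu (P : pred nat) : option nat :=
  match pselect (exists y, P y) with
  | left h => Some (ex_minn h)
  | right _ => None
  end.

(* Partial functions from omega^n to omega; [None] is "undefined", so that     *)
(* equality of partial functions is [=].                                       *)
Definition pfun (n : nat) := n.-tuple nat -> option nat.

Definition dom (n : nat) (f : pfun n) : set (n.-tuple nat) := [set x | f x].

Inductive primrec : forall n, (n.-tuple nat -> nat) -> Prop :=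
| primrec_zero n : primrec (fun _ : n.-tuple nat => 0)
| primrec_succ : primrec (fun x : 1.-tuple nat => (thead x).+1)
| primrec_proj n (i : 'I_n) : primrec (fun x => tnth x i)
| primrec_comp m n (f : m.-tuple nat -> nat) (g : 'I_m -> n.-tuple nat -> nat) :
    primrec f -> (forall i, primrec (g i)) ->
    primrec (fun x => f [tuple g i x | i < m])
| primrec_rec n (f : n.-tuple nat -> nat) (g : n.+2.-tuple nat -> nat) :
    primrec f -> primrec g ->
    primrec (fun x : n.+1.-tuple nat =>
      iteri (thead x) (fun k r => g [tuple of k :: r :: behead_tuple x])
        (f (behead_tuple x))).

(* Strict composition: defined only where all the inner functions are.         *)
Definition pcomp m n (f : pfun m) (g : 'I_m -> pfun n) : pfun n :=
  fun x => if [forall i, isSome (g i x)]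
           then f [tuple odflt 0 (g i x) | i < m] else None.

Definition prec n (f : pfun n) (g : pfun n.+2) : pfun n.+1 :=
  fun x => iteri (thead x)
    (fun k => obind (fun r => g [tuple of k :: r :: behead_tuple x]))
    (f (behead_tuple x)).

(* Kleene minimization: all values before the first zero must be defined.      *)
Definition pmin n (f : pfun n.+1) : pfun n :=
  fun x => mu (fun y => (f [tuple of y :: x] == Some 0)
                        && [forall z : 'I_y, isSome (f [tuple of nat_of_ord z :: x])]).

Inductive partrec : forall n, pfun n -> Prop :=
| partrec_zero n : partrec (fun _ : n.-tuple nat => Some 0)
| partrec_succ : partrec (fun x : 1.-tuple nat => Some (thead x).+1)
| partrec_proj n (i : 'I_n) : partrec (fun x => Some (tnth x i))
| partrec_comp m n (f : pfun m) (g : 'I_m -> pfun n) :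
    partrec f -> (forall i, partrec (g i)) -> partrec (pcomp f g)
| partrec_rec n (f : pfun n) (g : pfun n.+2) :
    partrec f -> partrec g -> partrec (prec f g)
| partrec_min n (f : pfun n.+1) : partrec f -> partrec (pmin f).

Definition computable n (f : n.-tuple nat -> nat) : Prop :=
  partrec (fun x => Some (f x)).

Definition computable_pred n (T : pred (n.-tuple nat)) : Prop :=
  computable (fun x => nat_of_bool (T x)).

Definition primrec1 (f : nat -> nat) : Prop :=
  primrec (fun x : 1.-tuple nat => f (thead x)).

Definition computable1 (f : nat -> nat) : Prop :=
  computable (fun x : 1.-tuple nat => f (thead x)).

Definition computable2 (f : nat -> nat -> nat) : Prop :=
  computable (fun x : 2.-tuple nat => f (tnth x ord0) (tnth x ord_max)).

Definition ce (A : set nat) : Prop :=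
  exists2 f : pfun 1, partrec f & A = [set a | f [tuple a]].

Definition pairing (cp : nat -> nat -> nat) : Prop :=
  [/\ computable2 cp,
      bijective (fun p : nat * nat => cp p.1 p.2)
    & forall x y, x <= cp x y /\ y <= cp x y].

(* <x_1, ..., x_m>, associated to the right; the value on the empty sequence   *)
(* is a dummy.                                                                 *)
Fixpoint code (cp : nat -> nat -> nat) (s : seq nat) : nat :=
  match s with
  | [::] => 0
  | [:: x] => x
  | x :: s' => cp x (code cp s')
  end.

Definition Anf (A : set nat) (n : nat) : set (pfun n) :=
  [set f | dom f = set0 \/
           exists2 a, A a & dom f = [set x | forall i, tnth x i < a]].

Definition total_computable (n : nat) : set (pfun n) :=
  [set f | exists2 g : n.-tuple nat -> nat,
             computable g & f = (fun x => Some (g x))].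

Definition SA (A : set nat) (n : nat) : set (pfun n) :=
  @total_computable n `|` @Anf A n.

Definition numbering (U : Type) (X : set U) (theta : nat -> U) : Prop :=
  range theta = X.

Definition extended_graph (cp : nat -> nat -> nat) m (q : pfun m) : set nat :=
  [set cp (code cp y) 0 | y in [set: m.-tuple nat]]
  `|` [set w | exists x z, q x = Some z /\ w = cp (code cp x) z.+1].

Definition universal_fun n (theta : nat -> pfun n) : pfun n.+1 :=
  fun v => theta (thead v) (behead_tuple v).

Definition QGN_I (cp : nat -> nat -> nat) n (theta : nat -> pfun n) : Prop :=
  exists2 h : nat -> nat,
    computable1 h & range h = extended_graph cp (universal_fun theta).

(* Main.v *)
Require Import Defs.
From mathcomp Require Import all_boot.
From mathcomp Require Import boolp classical_sets functions cardinality.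
From mathcomp Require Import zify.

(* Fix a primitive recursive [q] taking every value infinitely often, and let
   [h] enumerate the extended graph.  Let T(i, x, y) say that the equation
   "theta_i(x) = q(y)" has been enumerated by [h] before stage [y].  Any [y]
   satisfying T gives the right value; and if theta_i(x) = z is enumerated at
   stage [s], then some [y > s] has [q y = z]. *)

Set Implicit Arguments.
Unset Strict Implicit.
Unset Printing Implicit Defensive.

(* Both [primrec] and the total functions among [partrec] satisfy this, so the
   closure properties below are proved once for the two classes. *)
Record rec_closed (C : forall n, (n.-tuple nat -> nat) -> Prop) : Prop :=
  RecClosed {
    rc_zero n : C n (fun=> 0);
    rc_succ : C 1 (fun x => (thead x).+1);
    rc_proj n (i : 'I_n) : C n (fun x => tnth x i);
    rc_comp m n (f : m.-tuple nat -> nat) (g : 'I_m -> n.-tuple nat -> nat) :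
      C m f -> (forall i, C n (g i)) -> C n (fun x => f [tuple g i x | i < m]);
    rc_rec n (f : n.-tuple nat -> nat) (g : n.+2.-tuple nat -> nat) :
      C n f -> C n.+2 g ->
      C n.+1 (fun x : n.+1.-tuple nat =>
        iteri (thead x) (fun k r => g [tuple of k :: r :: behead_tuple x])
          (f (behead_tuple x))) }.

Lemma primrec_closed : rec_closed primrec.
Proof.
split; [exact: primrec_zero | exact: primrec_succ | exact: primrec_proj
       | exact: primrec_comp | exact: primrec_rec].
Qed.

Lemma computable_closed : rec_closed computable.
Proof.
split; [exact: partrec_zero | exact: partrec_succ | exact: partrec_proj | |].
- move=> m n f g cf cg; rewrite /computable.
  (* The inner functions are total, so the definedness test in [pcomp] always succeeds. *)
  have -> : (fun x => Some (f [tuple g i x | i < m]))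
      = Defs.pcomp (fun x => Some (f x)) (fun i x => Some (g i x)).
    by apply: funext => x; rewrite /Defs.pcomp; case: forallP => // [[]].
  exact: partrec_comp.
- move=> n f g cf cg; rewrite /computable.
  set F := fun x => Some _.
  have -> : F = prec (fun x => Some (f x)) (fun x => Some (g x)).
    apply: funext => x; rewrite /F /prec.
    by elim: (thead x) => [|k IHk] //=; rewrite -IHk.
  exact: partrec_rec.
Qed.

Section RecClosed.

Context (C : forall n, (n.-tuple nat -> nat) -> Prop) (clC : rec_closed C).

(** Out-of-range indices give the constant 0, so arguments can be named by plain numbers without
    bound proofs. *)
Lemma rc_nth n i : C (fun x : n.-tuple nat => nth 0 x i).
Proof.
have [lt_in | le_ni] := ltnP i n.
  have -> : (fun x : n.-tuple nat => nth 0 x i)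
      = (fun x => tnth x (Ordinal lt_in)).
    by apply: funext => x; rewrite (tnth_nth 0).
  exact: rc_proj.
have -> : (fun x : n.-tuple nat => nth 0 x i) = fun=> 0.
  by apply: funext => x; rewrite nth_default // size_tuple.
exact: rc_zero.
Qed.

Lemma rc_comp1 (f : nat -> nat) n (g : n.-tuple nat -> nat) :
  C (fun x : 1.-tuple nat => f (thead x)) -> C g -> C (fun x => f (g x)).
Proof.
move=> Cf Cg; have := rc_comp clC Cf (fun=> Cg).
by congr C; apply: funext => x; rewrite /thead tnth_mktuple.
Qed.

Lemma rc_comp2 (f : nat -> nat -> nat) n (g1 g2 : n.-tuple nat -> nat) :
  C (fun x : 2.-tuple nat => f (nth 0 x 0) (nth 0 x 1)) -> C g1 -> C g2 ->
  C (fun x => f (g1 x) (g2 x)).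
Proof.
move=> Cf Cg1 Cg2.
have Cg (i : 'I_2) : C (if i == 0 :> nat then g1 else g2) by case: ifP.
have := rc_comp clC Cf Cg.
congr C; apply: funext => x.
by rewrite -!(tnth_nth 0 _ ord0) -!(tnth_nth 0 _ ord_max) !tnth_mktuple.
Qed.

Lemma rc_S n (g : n.-tuple nat -> nat) : C g -> C (fun x => (g x).+1).
Proof. exact: rc_comp1 (rc_succ clC). Qed.

Lemma rc_rec1 (g : nat -> nat -> nat) :
  C (fun x : 2.-tuple nat => g (nth 0 x 0) (nth 0 x 1)) ->
  C (fun x : 1.-tuple nat => iteri (thead x) g 0).
Proof. exact: (rc_rec clC (rc_zero clC 0)). Qed.

Lemma rc_rec2 (f : nat -> nat) (g : nat -> nat -> nat -> nat) :
  C (fun x : 1.-tuple nat => f (nth 0 x 0)) ->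
  C (fun x : 3.-tuple nat => g (nth 0 x 0) (nth 0 x 1) (nth 0 x 2)) ->
  C (fun x : 2.-tuple nat =>
       iteri (nth 0 x 0) (fun k r => g k r (nth 0 x 1)) (f (nth 0 x 1))).
Proof.
move=> Cf Cg; have := rc_rec clC Cf Cg; congr C; apply: funext => x.
by rewrite /thead (tnth_nth 0) /= nth_behead.
Qed.

Lemma rc_add n (f g : n.-tuple nat -> nat) :
  C f -> C g -> C (fun x => f x + g x).
Proof.
apply: rc_comp2.
have := @rc_rec2 id (fun _ r _ => r.+1) (rc_nth _ _) (rc_S (rc_nth _ _)).
congr C; apply: funext => x.
by elim: (nth 0 x 0) => //= k ->.
Qed.

Lemma rc_sub n (f g : n.-tuple nat -> nat) :
  C f -> C g -> C (fun x => f x - g x).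
Proof.
have Cpred : C (fun x : 1.-tuple nat => (thead x).-1).
  have := @rc_rec1 (fun k _ => k) (rc_nth _ _).
  by congr C; apply: funext => x; case: (thead x).
(* The recursion iterates the predecessor along the subtrahend, which must therefore be the first
   argument. *)
move=> Cf Cg; apply: (@rc_comp2 (fun b a => a - b)) => //.
have := @rc_rec2 id (fun _ r _ => r.-1) (rc_nth _ _) (rc_comp1 Cpred (rc_nth _ _)).
congr C; apply: funext => x.
by elim: (nth 0 x 0) => /= [|k ->]; rewrite ?subn0 ?subnS.
Qed.

Lemma rc_ifz n (f g : n.-tuple nat -> nat) :
  C f -> C g -> C (fun x => if f x == 0 then g x else 0).
Proof.
apply: (@rc_comp2 (fun a b => if a == 0 then b else 0)).
(* A recursion step that ignores the previous value is a case distinction on zero. *)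
have := @rc_rec2 id (fun _ _ _ => 0) (rc_nth _ _) (rc_zero clC _).
by congr C; apply: funext => x; case: (nth 0 x 0).
Qed.

Lemma rc_negb n (P : pred (n.-tuple nat)) :
  C (fun x => P x : nat) -> C (fun x => ~~ P x : nat).
Proof.
move=> CP; have := rc_ifz CP (rc_S (rc_zero clC n)).
by congr C; apply: funext => x; case: (P x).
Qed.

Lemma rc_eq n (f g : n.-tuple nat -> nat) :
  C f -> C g -> C (fun x => f x == g x : nat).
Proof.
move=> Cf Cg.
(* Two numbers are equal when both truncated differences vanish. *)
have := rc_ifz (rc_sub Cf Cg) (rc_ifz (rc_sub Cg Cf) (rc_S (rc_zero clC n))).
by congr C; apply: funext => x; rewrite !subn_eq0 eqn_leq; do 2!case: leq.
Qed.

Lemma rc_has_iota (h : nat -> nat) n (f g : n.-tuple nat -> nat) :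
  C (fun x : 1.-tuple nat => h (thead x)) -> C f -> C g ->
  C (fun x => has (fun s => h s == g x) (iota 0 (f x)) : nat).
Proof.
move=> Ch; apply: (@rc_comp2 (fun k c => has (fun s => h s == c) (iota 0 k))).
set P := fun x : 2.-tuple nat =>
  has (fun s => h s == nth 0 x 1) (iota 0 (nth 0 x 0)).
(* [rc_ifz] returns 0 in its other branch, so the natural recursion computes the negation: it starts
   at 1 and drops to 0 for good at the first hit. *)
suff /rc_negb : C (fun x => ~~ P x : nat).
  by congr C; apply: funext => x; rewrite negbK.
have := @rc_rec2 (fun=> 1) (fun k r c => if (h k == c) == 0 :> nat then r else 0)
  (rc_S (rc_zero clC _))
  (rc_ifz (rc_eq (rc_comp1 Ch (rc_nth _ _)) (rc_nth _ _)) (rc_nth _ _)).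
congr C; apply: funext => x; rewrite {}/P.
move: (nth 0 x 0) (nth 0 x 1) => k c; elim: k => // k.
rewrite -[in iota 0 k.+1](addn1 k) iotaD has_cat /= orbF => ->.
by case: (h k == c); rewrite ?orbT ?orbF.
Qed.

Lemma rc_code (cp : nat -> nat -> nat) n m k :
  C (fun x : 2.-tuple nat => cp (nth 0 x 0) (nth 0 x 1)) ->
  C (fun x : n.-tuple nat => code cp [seq nth 0 x j | j <- iota k m]).
Proof.
move=> Ccp; elim: m k => [|[|m] IHm] k; first exact: rc_zero.
  exact: rc_nth.
exact: rc_comp2 Ccp (rc_nth _ _) (IHm k.+1).
Qed.

End RecClosed.

(* The test is [2 r <= k]: values climb until they exceed half of the argument,
   which postpones each reset long enough for every value to be reached. *)
Definition climb (y : nat) : nat :=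
  iteri y (fun k r => if r + r - k == 0 then r.+1 else 0) 0.

(** Kept generic in [C] because [climb] serves twice: as the primitive recursive [q] and inside the
    computable predicate [T]. *)
Lemma rc_climb C : rec_closed C -> C 1 (fun x => climb (thead x)).
Proof.
move=> cl.
apply: (rc_rec1 cl); apply: (rc_ifz cl); last exact: (rc_S cl (rc_nth cl _ _)).
apply: (rc_sub cl); last exact: rc_nth.
by apply: (rc_add cl); exact: rc_nth.
Qed.

Lemma climb_eq0 s : exists2 y, s <= y & climb y = 0.
Proof.
(* With no reset from [s] on, [climb] would gain one per step, while the threshold gains only one
   half. *)
case: (pselect (exists2 y, s <= y & climb y = 0)) => // no_drop.
have climbD j : climb (s + j) = climb s + j.
  elim: j => [|j IHj]; first by rewrite !addn0.
  case: (eqVneq (climb (s + j.+1)) 0) => [drop|].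
    by case: no_drop; exists (s + j.+1); rewrite ?leq_addr.
  by rewrite addnS /= -/(climb _) IHj addnS; case: ifP.
(* At argument [s + s.+1] the value is at least [s.+1], whose double exceeds the argument, so the
   next value is 0. *)
case: no_drop; exists (s + s.+1).+1; first lia.
by rewrite /= -/(climb _) climbD; case: ifP => //; lia.
Qed.

Lemma climb_infinitely_often z s : exists2 y, s < y & climb y = z.
Proof.
(* Start from a zero beyond [2 z]: every [j < z] then passes the test, so the climb reaches [z]
   without a reset. *)
have [y le_y y0] := climb_eq0 (s + z + z).+1.
have climbD j : j <= z -> climb (y + j) = j.
  elim: j => [|j IHj] lt_jz; first by rewrite addn0.
  by rewrite addnS /= -/(climb _) IHj 1?ltnW //; case: ifP => //; lia.
by exists (y + z); [lia | exact: climbD].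
Qed.

Lemma mu_spec (P : pred nat) :
  match mu P return Prop with Some y => P y | None => forall y, ~~ P y end.
Proof.
rewrite /mu; case: pselect => [exP | noP]; first by case: ex_minnP.
by move=> y; apply/negP => Py; apply: noP; exists y.
Qed.

Lemma pairing_inj cp x y x' y' :
  pairing cp -> cp x y = cp x' y' -> x = x' /\ y = y'.
Proof. by case=> _ /bij_inj cpI _ /(cpI (x, y) (x', y')) []. Qed.

(** Equal lengths are essential: [[:: cp x y]] and [[:: x; y]] have the same code. *)
Lemma code_inj cp s t :
  pairing cp -> size s = size t -> code cp s = code cp t -> s = t.
Proof.
move=> hcp; elim: s t => [|x s IHs] [|y t] //= [eq_st].
case: s t IHs eq_st => [|x' s] [|y' t] // IHs eq_st; first by move=> ->.
by case/(pairing_inj hcp) => -> /(IHs _ eq_st) ->.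
Qed.

(** The second component [z.+1] excludes the padding pairs, which end in 0; injectivity of the
    coding then recovers the argument and the value. *)
Lemma extended_graph_succ cp m (q : pfun m) (x : m.-tuple nat) z :
  pairing cp ->
  extended_graph cp q (cp (code cp x) z.+1) <-> q x = Some z.
Proof.
move=> hcp; split=> [[[y _] | [y [w [qy]]]] | qx].
- by case/(pairing_inj hcp).
- case/(pairing_inj hcp) => /(code_inj hcp); rewrite !size_tuple => /(_ erefl).
  by move=> /val_inj -> [->].
- by right; exists x, z.
Qed.

Theorem theorem4p1 (cp : nat -> nat -> nat) (hcp : pairing cp)
    (A : set nat) (hAinf : infinite_set A) (hAce : ce A)
    (n : nat) (hn : 1 <= n)
    (theta : nat -> pfun n) (htheta : numbering (@SA A n) theta)
    (hQGN : QGN_I cp theta) :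
  exists (q : nat -> nat) (T : pred (n.+2.-tuple nat)),
    [/\ primrec1 q, computable_pred T
      & forall (i : nat) (x : n.-tuple nat),
          theta i x = omap q (mu (fun y => T [tuple of i :: rcons x y]))].
Proof.
case: hQGN => h comp_h range_h; have cl := computable_closed.
(* Entries 0 to [n] of [v] are [i] and [x], entry [n.+1] is the stage [y]; the search bounded by [y]
   keeps [T] decidable. *)
pose T (v : n.+2.-tuple nat) :=
  has (fun s => h s == cp (code cp [seq nth 0 v j | j <- iota 0 n.+1])
                          (climb (nth 0 v n.+1)).+1)
      (iota 0 (nth 0 v n.+1)).
exists climb, T; split; first exact: (rc_climb primrec_closed).
  have comp_cp : computable (fun x : 2.-tuple nat => cp (nth 0 x 0) (nth 0 x 1)).
    case: hcp => + _ _; congr computable.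
    by apply: funext => x; rewrite !(tnth_nth 0).
  apply: (rc_has_iota cl comp_h); first exact: rc_nth.
  apply: (rc_comp2 cl comp_cp); first exact: (rc_code cl _ _ _ comp_cp).
  exact: (rc_S cl (rc_comp1 cl (rc_climb cl) (rc_nth cl _ _))).
move=> i x.
have enumP z : theta i x = Some z <->
    exists s, h s = cp (code cp (i :: x)) z.+1.
  have := extended_graph_succ (universal_fun theta) [tuple of i :: x] z hcp.
  have -> : universal_fun theta [tuple of i :: x] = theta i x.
    by rewrite /universal_fun theadE; congr theta; apply: val_inj.
  by rewrite -range_h => <-; split=> [[s _ <-] | [s hs]]; exists s.
have TE y : T [tuple of i :: rcons x y]
    = has (fun s => h s == cp (code cp (i :: x)) (climb y).+1) (iota 0 y).
  rewrite /T /= nth_rcons size_tuple ltnn eqxx.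
  have -> // : [seq nth 0 (i :: rcons x y) j | j <- iota 1 n] = x.
  rewrite map_nth_iota /= ?size_rcons ?size_tuple ?add1n // drop0.
  by rewrite -cats1 take_size_cat ?size_tuple.
have := mu_spec (fun y => T [tuple of i :: rcons x y]).
case: mu => [y | noT] /=.
  by rewrite TE => /hasP[s _ /eqP hs]; apply/enumP; exists s.
case theta_z: (theta i x) => [z|] //.
have /enumP[s hs] := theta_z.
have [y lt_sy climb_y] := climb_infinitely_often z s.
have /negP[] := noT y; rewrite TE; apply/hasP; exists s.
  by rewrite mem_iota.
by rewrite climb_y hs.
Qed.
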